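(* Let $p_0>1$. Suppose that the oscillation space $X(\mathcal{B},\Lambda)$ satisfies the $p$-power John-Nirenberg property for $[1,p_0]$ and that $X(\mathcal{B},\Lambda)=X^p(\mathcal{B},\Lambda)$ for all $0<p\le 1$. Then $X(\mathcal{B},\Lambda)$ satisfies the weight invariance property for $RH_{p_0'}(\mathcal{B})$. In particular, for each $1<q<\infty$ and each $w\in A_q(\mathcal{B})\cap RH_{p_0'}(\mathcal{B})$, $$\big(c_{1/q,1}\,[w]_{A_q}\big)^{-1}\|f\|_X\le \|f\|_{X_w}\le c_{1,p_0}\,[w]_{RH_{p_0'}}\,\|f\|_X\qquad\text{for all } f\in X(\mathcal{B},\Lambda).$$ If in addition $w\in RH_\sigma(\mathcal{B})$ for some $\sigma>p_0'$, then $X_w(\mathcal{B},\Lambda)$ satisfies the $p$-power John-Nirenberg property for $(0,p_0/\sigma']$ and $$c_{1,p_0/\sigma'}(w)\le c_{1,p_0}\,c_{1/q,1}\,\big([w]_{RH_\sigma}\big)^{\frac{\sigma}{p_0(\sigma-p_0')}}\,[w]_{A_q}.$$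
   Context: Setting. $(Y,\Sigma,\mu)$ is a measure space with $\mu$ non-negative and $\sigma$-finite, and $\mathcal{B}\subset\Sigma$ is a collection of sets with $0<\mu(B)<\infty$ for all $B\in\mathcal{B}$. A function is locally $\mu$-integrable if it is $\mu$-measurable and integrable over every $B\in\mathcal{B}$. For $1<p<\infty$, $p'=p/(p-1)$. Weights. For $1<p<\infty$, a non-negative locally $\mu$-integrable function $w$ belongs to $A_p(\mathcal{B})$ if $$[w]_{A_p}=\sup_{B\in\mathcal{B}}\Big(\frac1{\mu(B)}\int_B w\,d\mu\Big)\Big(\frac1{\mu(B)}\int_B w^{-p'/p}\,d\mu\Big)^{p/p'}<\infty$$ (finiteness includes finiteness of each average, so $0<w(B)<\infty$, where $w(B)=\int_B w\,d\mu$). $A_\infty(\mathcal{B})=\bigcup_{1<p<\infty}A_p(\mathcal{B})$. For $1<\delta<\infty$, $RH_\delta(\mathcal{B})$ is the set of $w\in A_\infty(\mathcal{B})$ for which there is a constant $C$ with $\big(\frac1{\mu(B)}\int_B w^\delta d\mu\big)^{1/\delta}\le C\,\frac1{\mu(B)}\int_B w\,d\mu$ for all $B\in\mathcal{B}$; $[w]_{RH_\delta}$ is the smallest such $C$. Oscillation spaces. $\mathfrak{F}$ is a set and $\Lambda$ assigns to each $(f,B)\in\mathfrak{F}\times\mathcal{B}$ a non-negative $\mu$-measurable function $\Lambda(f,B)$ on $Y$. For $w\in A_\infty(\mathcal{B})$ and $0<p<\infty$, put $\|f\|_{X_w^p}=\Big(\sup_{B\in\mathcal{B}}\frac1{w(B)}\int_B\Lambda(f,B)^p\,w\,d\mu\Big)^{1/p}\in[0,\infty]$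 and let $X_w^p(\mathcal{B},\Lambda)=\{f\in\mathfrak{F}:\|f\|_{X_w^p}<\infty\}$. Write $X^p=X_1^p$, $X_w=X_w^1$, $X=X_1^1$. (No vector space or norm structure is assumed.) Weight invariance. $X(\mathcal{B},\Lambda)$ satisfies the weight invariance property for $\mathcal{W}\subset A_\infty(\mathcal{B})$ if for all $w,v\in\mathcal{W}$, $X_w(\mathcal{B},\Lambda)=X_v(\mathcal{B},\Lambda)$ and there is a constant $b_{w,v}>0$ with $\|f\|_{X_v}\le b_{w,v}\|f\|_{X_w}$ for all $f\in X_w(\mathcal{B},\Lambda)$. $p$-power John-Nirenberg property. $X_w(\mathcal{B},\Lambda)$ satisfies this property for an interval $I\subset(0,\infty)$ if for any $p<q$ in $I$ there is a constant $C>0$ (possibly depending on $w,p,q$) such that $\|f\|_{X_w^q}\le C\|f\|_{X_w^p}$ for all $f\in X_w(\mathcal{B},\Lambda)$. The infimum of such constants is $c_{p,q}(w)$, and $c_{p,q}=c_{p,q}(1)$. *)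

(* Defs.v *)
From HB Require Import structures.
From mathcomp Require Import all_boot all_order all_algebra.
From mathcomp Require Import all_classical all_reals all_analysis.
From mathcomp Require Import measurable_realfun.

Set Implicit Arguments.
Unset Strict Implicit.
Unset Printing Implicit Defensive.

Import Order.TTheory GRing.Theory Num.Theory.
Import numFieldNormedType.Exports.

Local Open Scope classical_set_scope.
Local Open Scope ring_scope.
Local Open Scope ereal_scope.

(* Suprema of families of non-negative extended reals are taken in [0, +oo],
   so that the supremum of the empty family is 0 (and not -oo). *)
Definition sup_ge0 (R : realType) (S : set (\bar R)) : \bar R :=
  ereal_sup (0 |` S).

Definition conj_exp (R : realType) (p : R) : R := (p / (p - 1))%R.

Section weights.
Context (R : realType) (d : measure_display) (Y : measurableType d).
Context (mu : {sigma_finite_measure set Y -> \bar R}).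
Context (BB : set (set Y)).

(* Weights take values in [0, +oo]; real-valued weights are a special case. *)
Implicit Type w : Y -> \bar R.

Definition admissible_sets : Prop :=
  forall B, BB B -> measurable B /\ 0 < mu B < +oo.

Definition BB_integrable w : Prop :=
  measurable_fun [set: Y] w /\ forall B, BB B -> mu.-integrable B w.

Definition avg (B : set Y) (g : Y -> \bar R) : \bar R :=
  (mu B)^-1 * \int[mu]_(x in B) g x.

(* w^(-p'/p) is written (w^-1)^(p'/p): the library has 0^-1 = +oo for extended
   reals, whereas 0 `^ r = 0 for negative r. *)
Definition dual_weight (p : R) w : Y -> \bar R :=
  fun x => ((w x)^-1) `^ (conj_exp p / p).

Definition Ap_const (p : R) w : \bar R :=
  sup_ge0 [set avg B w * avg B (dual_weight p w) `^ (p / conj_exp p) | B in BB].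

(* The finiteness of the second average is not a consequence of that of the
   product, since 0 * +oo = 0 in the library. *)
Definition Ap (p : R) : set (Y -> \bar R) :=
  [set w | [/\ forall x, 0 <= w x, BB_integrable w,
    (forall B, BB B -> avg B (dual_weight p w) < +oo) & Ap_const p w < +oo]].

Definition Ainfty : set (Y -> \bar R) := [set w | exists2 p : R, (1 < p)%R & Ap p w].

Definition RH_bounds (delta : R) w : set R :=
  [set C | (0 <= C)%R /\ forall B, BB B ->
    avg B (fun x => w x `^ delta) `^ delta^-1 <= C%:E * avg B w].

Definition RH (delta : R) : set (Y -> \bar R) :=
  [set w | Ainfty w /\ RH_bounds delta w !=set0].

Definition RH_const (delta : R) w : \bar R :=
  ereal_inf [set C%:E | C in RH_bounds delta w].

End weights.

Section oscillation.
Context (R : realType) (d : measure_display) (Y : measurableType d).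
Context (mu : {sigma_finite_measure set Y -> \bar R}).
Context (BB : set (set Y)) (F : Type) (Lambda : F -> set Y -> Y -> \bar R).
Implicit Type w : Y -> \bar R.

Definition oscillation : Prop := forall f B, BB B ->
  measurable_fun [set: Y] (Lambda f B) /\ forall x, 0 <= Lambda f B x.

Definition Xnorm w (p : R) (f : F) : \bar R :=
  (sup_ge0 [set (\int[mu]_(x in B) w x)^-1 *
                \int[mu]_(x in B) (Lambda f B x `^ p * w x) | B in BB]) `^ p^-1.

Definition Xspace w (p : R) : set F := [set f | Xnorm w p f < +oo].

Definition weight_invariance (W : set (Y -> \bar R)) : Prop :=
  forall w v, W w -> W v ->
    Xspace w 1 = Xspace v 1 /\
    exists2 b : R, (0 < b)%R &
      forall f, Xspace w 1 f -> Xnorm v 1 f <= b%:E * Xnorm w 1 f.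

Definition JN_bounds w (p q : R) : set R :=
  [set C | (0 < C)%R /\
    forall f, Xspace w 1 f -> Xnorm w q f <= C%:E * Xnorm w p f].

Definition john_nirenberg w (I : set R) : Prop :=
  forall p q, I p -> I q -> (p < q)%R -> JN_bounds w p q !=set0.

Definition JN_const w (p q : R) : \bar R :=
  ereal_inf [set C%:E | C in JN_bounds w p q].

End oscillation.

(* Main.v *)
Require Import Defs.
From HB Require Import structures.
From mathcomp Require Import all_boot all_order all_algebra.
From mathcomp Require Import all_classical all_reals all_analysis.
From mathcomp Require Import measurable_realfun.
From mathcomp Require Import ring lra.

Set Implicit Arguments.
Unset Strict Implicit.
Unset Printing Implicit Defensive.

Import Order.TTheory GRing.Theory Num.Theory.
Import numFieldNormedType.Exports.

Local Open Scope classical_set_scope.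
Local Open Scope ring_scope.
Local Open Scope ereal_scope.

(** Every step compares, on one set [B] at a time, two mean oscillations by
    Hoelder's inequality, and then takes suprema over [B].

    Lower bound. On [B], [Lambda^(1/q) = (Lambda w)^(1/q) w^(-1/q)]; Hoelder with
    exponents [q] and [q'] bounds the unweighted mean of [Lambda^(1/q)] by the
    [w]-mean of [Lambda] times the Muckenhoupt product, so that
    [|f|_{X^(1/q)} <= [w]_{A_q} |f|_{X_w}] ([Xnorm_le_Ap]). Hence
    [f] in [X_w] lies in [X^(1/q)], which is [X] by hypothesis, and the
    John-Nirenberg constant [c_{1/q,1}] lifts the left side to [|f|_X].

    That [c_{1/q,1}] is finite comes from the hypothesis on [[1, p0]]: mean
    oscillations are log-convex in the exponent ([mean_osc_log_convex]), so
    [|f|_X <= |f|_{X^p}^t |f|_{X^p0}^(1-t) <= |f|_{X^p}^t (C |f|_X)^(1-t)]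
    for [p < 1], and the finite quantity [|f|_X^(1-t)] cancels
    ([Xnorm_interpolation], [john_nirenberg_down]).

    Upper bound. Hoelder with exponents [delta'] and [delta] applied to
    [Lambda^(p0/delta') w], followed by the reverse Hoelder inequality of [w],
    gives [|f|_{X_w^r} <= C^(1/r) |f|_{X^p0}] with [r = p0/delta']
    ([Xnorm_le_RH]), and [|f|_{X^p0} <= c_{1,p0} |f|_X]. For [delta = p0'] the
    exponent [r] is 1, which yields the upper bound; the two bounds together
    give weight invariance. For [delta = sigma > p0'] one has [r > 1], and
    chaining with the lower bound controls [|f|_{X_w^r}] by [|f|_{X_w}]; the
    self-improvement described above, now for the weight [w], spreads this
    single estimate over [(0, r]]. The constant obtained in this way carries
    the power [sigma'/p0] of the reverse Hoelder constant; since that constant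
    is at least 1 it is dominated by the larger power of the statement. *)

(** * Extended real arithmetic *)

Section extended_reals.
Context (R : realType).
Implicit Types x y : \bar R.

Lemma ereal_young x y (a : R) : (0 < a < 1)%R -> 0 <= x -> 0 <= y ->
  x `^ a * y `^ (1 - a) <= a%:E * x + (1 - a)%:E * y.
Proof.
move=> /andP[a0 a1]; have b0 : (0 < 1 - a)%R by rewrite subr_gt0.
case: x => [x| |] // x0; case: y => [y| |] // y0.
- rewrite !poweR_EFin -!EFinM -EFinD lee_fin.
  have h := @conjugate_powR R (x `^ a)%R (y `^ (1 - a))%R a^-1%R (1 - a)^-1%R
    (powR_ge0 _ _) (powR_ge0 _ _).
  rewrite !invr_gt0 !invrK -!powRrM in h.
  rewrite !mulfV ?gt_eqF// !powRr1// in h.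
  by rewrite [(a * x)%R]mulrC [((1 - a) * y)%R]mulrC; apply: h => //; rewrite subrKC.
- by rewrite [in leRHS]gt0_muley ?lte_fin// addey ?leey// -EFinM.
- by rewrite [in leRHS]gt0_muley ?lte_fin// addye ?leey// -EFinM.
- by rewrite !gt0_muley ?lte_fin// leey.
Qed.

Lemma poweRD_ge0 x (a b : R) : (0 <= a)%R -> (0 <= b)%R ->
  x `^ (a + b) = x `^ a * x `^ b.
Proof.
rewrite le_eqVlt => /predU1P[<-|a0] b0; first by rewrite add0r poweRe0 mul1e.
by apply: poweRD; rewrite add_neq0_poweRD_def// gt_eqF// ltr_wpDr.
Qed.

Lemma le_poweR x y (r : R) : (0 <= r)%R -> 0 <= x -> x <= y -> x `^ r <= y `^ r.
Proof.
move=> r0 x0 xy; apply: gt0_ler_poweR => //; rewrite in_itv/= leey andbT//.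
exact: le_trans xy.
Qed.

Lemma ereal_inf_ge0 (S : set R) : (forall C, S C -> (0 <= C)%R) ->
  0 <= ereal_inf [set C%:E | C in S].
Proof. by move=> S0; apply: le_ereal_inf_tmp => _ [C /S0 C0 <-]; rewrite lee_fin. Qed.

Lemma ereal_inf_lty (S : set R) : S !=set0 -> ereal_inf [set C%:E | C in S] < +oo.
Proof.
move=> [C SC]; apply: le_lt_trans (ltry C).
by apply: ereal_inf_lbound; exists C.
Qed.

(** The infimum of admissible constants is itself admissible; at a vanishing
    right factor this needs one finite constant, since [+oo * 0 = 0]. *)
Lemma ereal_inf_EFin_mul (S : set R) x y :
  S !=set0 -> 0 <= y -> y < +oo ->
  (forall C, S C -> x <= C%:E * y) ->
  x <= ereal_inf [set C%:E | C in S] * y.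
Proof.
move=> [C0 SC0]; case: y => // y; rewrite lee_fin le_eqVlt => /predU1P[<-|y0] _ h.
  by have := h _ SC0; rewrite !mule0.
rewrite -lee_pdivrMr//; apply: le_ereal_inf_tmp => _ [C SC <-].
by rewrite lee_pdivrMr//; exact: h.
Qed.

(** Passing to a positive real constant, as the definitions of weight
    invariance and of the John-Nirenberg constants require. *)
Lemma real_upper_bound (K : \bar R) : 0 <= K -> K < +oo ->
  exists2 b : R, (0 < b)%R & forall x, 0 <= x -> K * x <= b%:E * x.
Proof.
case: K => // k k0 _; exists (k + 1)%R; first by rewrite ltr_wpDl.
by move=> x x0; apply: lee_wpmul2r => //; rewrite lee_fin lerDl.
Qed.

(** At [c = 0] the hypothesis forces [x = 0], and [+oo * 0 = 0]. *)
Lemma inve_mul_le (c x y : \bar R) : 0 <= c -> c < +oo ->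
  0 <= x -> 0 <= y -> x <= c * y -> c^-1 * x <= y.
Proof.
case: c => // c + _ x0 y0; rewrite lee_fin le_eqVlt => /predU1P[<-|c0].
  rewrite mul0e => xle0; have -> : x = 0 by apply/eqP; rewrite eq_le xle0.
  by rewrite mule0.
by move=> xcy; rewrite inver gt_eqF// lee_pdivrMl.
Qed.

Lemma sup_ge0_ubound (S : set (\bar R)) x : S x -> x <= sup_ge0 S.
Proof. by move=> Sx; apply: ereal_sup_ubound; right. Qed.

Lemma sup_ge0_ge0 (S : set (\bar R)) : 0 <= sup_ge0 S.
Proof. by apply: ereal_sup_ubound; left. Qed.

Lemma ge_sup_ge0 (S : set (\bar R)) y : 0 <= y -> ubound S y -> sup_ge0 S <= y.
Proof. by move=> y0 Sy; apply: ge_ereal_sup => x [->//|/Sy]. Qed.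

End extended_reals.

(** * Hoelder's inequality for [0, +oo]-valued functions *)

Section hoelder.
Context (R : realType) (d : measure_display) (T : measurableType d).
Context (mu : {measure set T -> \bar R}).
Implicit Types f g : T -> \bar R.

Lemma measurable_fun_poweR f (r : R) :
  measurable_fun [set: T] f -> measurable_fun [set: T] (fun x => f x `^ r).
Proof. exact: (measurableT_comp (measurable_poweR r)). Qed.

Lemma measurable_fun_inve f : (forall x, 0 <= f x) ->
  measurable_fun [set: T] f -> measurable_fun [set: T] (fun x => (f x)^-1).
Proof.
move=> f0 mf.
have -> : (fun x => (f x)^-1) = (fun x => if f x == 0 then +oo else
    if f x == +oo then 0 else f x `^ (-1)).
  apply/funext => x; have := f0 x; case: (f x) => [r||]// r0.
  rewrite inver eqe; case: ifPn => // rN0.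
  by rewrite poweR_EFin powR_inv1// -lee_fin.
apply: measurable_fun_ifT => //; first exact: measurable_fun_eqe.
apply: measurable_fun_ifT => //; first exact: measurable_fun_eqe.
exact: measurable_fun_poweR.
Qed.

Context (D : set T) (mD : measurable D).

Let mT f : measurable_fun [set: T] f -> measurable_fun D f.
Proof. exact: measurable_funTS. Qed.

(** Hoelder's inequality for [0, +oo]-valued functions, in the form of
    log-convexity in the exponent. When an integral on the right vanishes, its
    integrand is zero almost everywhere; when both are positive and one is
    infinite there is nothing to prove; otherwise both can be normalised and
    Young's inequality is integrated. *)
Lemma hoelder_ge0 f g (a : R) : (0 < a < 1)%R ->
  measurable_fun [set: T] f -> measurable_fun [set: T] g ->
  (forall x, 0 <= f x) -> (forall x, 0 <= g x) ->
  \int[mu]_(x in D) (f x `^ a * g x `^ (1 - a)) <=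
  (\int[mu]_(x in D) f x) `^ a * (\int[mu]_(x in D) g x) `^ (1 - a).
Proof.
move=> a01 mf mg f0 g0; case/andP: (a01) => a0 a1.
have b0 : (0 < 1 - a)%R by rewrite subr_gt0.
have mfa := measurable_fun_poweR a mf.
have mgb := measurable_fun_poweR (1 - a) mg.
have zero h c k (mh : measurable_fun [set: T] h) (h0 : forall x, 0 <= h x) : (0 < c)%R ->
    measurable_fun [set: T] k -> (forall x, 0 <= k x) ->
    \int[mu]_(x in D) h x = 0 -> \int[mu]_(x in D) (h x `^ c * k x) = 0.
  move=> c0 mk k0 ih0.
  rewrite -(integral0 mu D); apply: ge0_ae_eq_integral => //.
  - by apply: mT; apply: emeasurable_funM => //; exact: measurable_fun_poweR.
  - by move=> x _; rewrite mule_ge0// poweR_ge0.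
  - have : ae_eq mu D h (cst 0).
      apply/(ae_eq_integral_abs mu mD (mT mh)); rewrite -ih0.
      by apply: eq_integral => x _; rewrite gee0_abs.
    by apply: filterS => x /[apply] /= ->; rewrite poweR0r ?gt_eqF// mul0e.
have rhs0 : 0 <= (\int[mu]_(x in D) f x) `^ a * (\int[mu]_(x in D) g x) `^ (1 - a).
  by rewrite mule_ge0// poweR_ge0.
have [F0|F0] := eqVneq (\int[mu]_(x in D) f x) 0.
  by rewrite zero// => x; exact: poweR_ge0.
have [G0|G0] := eqVneq (\int[mu]_(x in D) g x) 0.
  under eq_integral do rewrite muleC.
  by rewrite zero// => x; exact: poweR_ge0.
have : 0 < \int[mu]_(x in D) f x by rewrite lt0e F0 integral_ge0.
have : 0 < \int[mu]_(x in D) g x by rewrite lt0e G0 integral_ge0.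
move: {F0 G0 rhs0 zero} (erefl (\int[mu]_(x in D) f x)) (erefl (\int[mu]_(x in D) g x)).
case: {1 3 4}(\int[mu]_(x in D) f x) => [F| |] //; last first.
  move=> _ _ G0 _; rewrite poweRyr ?gt_eqF// gt0_mulye ?leey//.
  exact: poweR_gt0.
case: {1 3 4}(\int[mu]_(x in D) g x) => [G| |] //; last first.
  move=> _ _ _ F0; rewrite poweRyr ?gt_eqF// gt0_muley ?leey//.
  exact: poweR_gt0.
move=> eF eG; rewrite !lte_fin => G0 F0; rewrite !poweR_EFin.
pose k := (F `^ a * G `^ (1 - a))%R.
have k0 : (0 <= k)%R by rewrite mulr_ge0// powR_ge0.
have young x : f x `^ a * g x `^ (1 - a) <=
    (k * (a / F))%:E * f x + (k * ((1 - a) / G))%:E * g x.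
  have F1 : (0 <= F^-1)%R by rewrite invr_ge0 ltW.
  have G1 : (0 <= G^-1)%R by rewrite invr_ge0 ltW.
  have := @ereal_young R (F^-1%:E * f x) (G^-1%:E * g x) a a01.
  rewrite !mule_ge0// => /(_ isT isT).
  rewrite !poweRM// !poweR_EFin muleACA -EFinM => h.
  have kinv : (F^-1 `^ a * G^-1 `^ (1 - a))%R = k^-1%R.
    rewrite /k -(powR_inv1 (ltW F0)) -(powR_inv1 (ltW G0)).
    by rewrite -!powRrM !mulN1r !powRN invfM.
  have kp : (0 < k)%R by rewrite mulr_gt0// powR_gt0.
  rewrite kinv lee_pdivrMl// in h.
  apply: (le_trans h); rewrite ge0_muleDr ?mule_ge0// ?lee_fin ?(ltW a0) ?(ltW b0)//.
  by rewrite !muleA -!EFinM !mulrA.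
apply: (@le_trans _ _ (\int[mu]_(x in D)
    ((k * (a / F))%:E * f x + (k * ((1 - a) / G))%:E * g x))).
  apply: ge0_le_integral => //.
  - by move=> x _; rewrite mule_ge0// poweR_ge0.
  - by apply: mT; exact: emeasurable_funM.
  - by apply: mT; apply: emeasurable_funD; exact: emeasurable_funM.
have kF : (0 <= k * (a / F))%R by rewrite mulr_ge0// divr_ge0// ltW.
have kG : (0 <= k * ((1 - a) / G))%R by rewrite mulr_ge0// divr_ge0// ltW.
rewrite ge0_integralD//; last first.
- by apply: mT; exact: emeasurable_funM.
- by move=> x _; rewrite mule_ge0.
- by apply: mT; exact: emeasurable_funM.
- by move=> x _; rewrite mule_ge0.
rewrite !ge0_integralZl_EFin//; try exact: mT.
rewrite -eF -eG -!EFinM -EFinD lee_fin -/k le_eqVlt; apply/orP; left; apply/eqP.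
by field; rewrite !gt_eqF.
Qed.

(** Hoelder's inequality for the measure [k mu]; averages over [B] are the case
    [k = 1 / mu B]. *)
Lemma hoelder_scaled f g (a k : R) : (0 < a < 1)%R -> (0 <= k)%R ->
  measurable_fun [set: T] f -> measurable_fun [set: T] g ->
  (forall x, 0 <= f x) -> (forall x, 0 <= g x) ->
  k%:E * \int[mu]_(x in D) (f x `^ a * g x `^ (1 - a)) <=
  (k%:E * \int[mu]_(x in D) f x) `^ a *
  (k%:E * \int[mu]_(x in D) g x) `^ (1 - a).
Proof.
move=> a01 k0 mf mg f0 g0; have /andP[a0 a1] := a01.
have if0 : 0 <= \int[mu]_(x in D) f x by apply: integral_ge0.
have ig0 : 0 <= \int[mu]_(x in D) g x by apply: integral_ge0.
rewrite !poweRM// muleACA -poweRD_ge0 ?(ltW a0) ?subr_ge0 ?(ltW a1)//.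
by rewrite subrKC poweRe1// lee_wpmul2l//; exact: hoelder_ge0.
Qed.

End hoelder.

(** * Mean oscillations and their dependence on the exponent *)

Section oscillation_means.
Context (R : realType) (d : measure_display) (Y : measurableType d).
Context (mu : {sigma_finite_measure set Y -> \bar R}).
Context (BB : set (set Y)) (F : Type) (Lambda : F -> set Y -> Y -> \bar R).
Hypothesis hBB : admissible_sets mu BB.
Hypothesis hLambda : oscillation BB Lambda.
Implicit Types (w : Y -> \bar R) (f : F).

(** The property of [w] that makes [w dmu / w(B)] a probability measure on each
    [B]; it covers at once the constant weight 1 and the Muckenhoupt weights. *)
Definition positive_weight w : Prop :=
  [/\ measurable_fun [set: Y] w, forall x, 0 <= w x &
      forall B, BB B -> 0 < \int[mu]_(x in B) w x < +oo].

Definition mean_osc w (p : R) f (B : set Y) : \bar R :=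
  (\int[mu]_(x in B) w x)^-1 * \int[mu]_(x in B) (Lambda f B x `^ p * w x).

Lemma measure_EFin B : BB B -> exists2 m : R, (0 < m)%R & mu B = m%:E.
Proof.
move=> /hBB[_ /andP[B0 Boo]]; exists (fine (mu B)); first exact/fine_gt0/andP.
by rewrite fineK// ge0_fin_numE// ltW.
Qed.

Lemma integral_weight_EFin w B : positive_weight w -> BB B ->
  exists2 m : R, (0 < m)%R & \int[mu]_(x in B) w x = m%:E.
Proof.
move=> [_ w0 wB] /wB /andP[B0 Boo].
exists (fine (\int[mu]_(x in B) w x)); first exact/fine_gt0/andP.
by rewrite fineK// ge0_fin_numE// integral_ge0.
Qed.

Lemma positive_weight_cst1 : positive_weight (cst 1).
Proof.
split => [|x|B BB_B]; [exact: measurable_cst|exact: lee01|].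
have [mB muB] := hBB BB_B.
by rewrite integral_cst// mul1e.
Qed.

Lemma measurable_osc f B p : BB B -> measurable_fun [set: Y] (fun x => Lambda f B x `^ p).
Proof. by move=> BB_B; apply: measurable_fun_poweR; case: (hLambda f BB_B). Qed.

Lemma osc_ge0 f B x : BB B -> 0 <= Lambda f B x.
Proof. by move=> BB_B; case: (hLambda f BB_B). Qed.

Lemma mean_osc_ge0 w p f B : (forall x, 0 <= w x) -> 0 <= mean_osc w p f B.
Proof.
move=> w0; rewrite mule_ge0 ?inve_ge0 ?integral_ge0// => x _.
by rewrite mule_ge0 ?poweR_ge0.
Qed.

Lemma mean_osc1 p f B : BB B ->
  mean_osc (cst 1) p f B = avg mu B (fun x => Lambda f B x `^ p).
Proof.
move=> BB_B; have [mB _] := hBB BB_B.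
rewrite /mean_osc /avg integral_cst// mul1e; congr (_ * _).
by apply: eq_integral => x _; rewrite mule1.
Qed.

Lemma avg_weight_EFin w B : positive_weight w -> BB B ->
  exists2 k : R, (0 < k)%R & avg mu B w = k%:E.
Proof.
move=> nw BB_B; have [m m0 muB] := measure_EFin BB_B.
have [W W0 wB] := integral_weight_EFin nw BB_B.
exists (m^-1 * W)%R; first by rewrite mulr_gt0// invr_gt0.
by rewrite /avg muB wB inver gt_eqF// -EFinM.
Qed.

Lemma avg_mean_osc w p f B : positive_weight w -> BB B ->
  avg mu B (fun x => Lambda f B x `^ p * w x) = avg mu B w * mean_osc w p f B.
Proof.
move=> nw BB_B; have [m m0 muB] := measure_EFin BB_B.
have [W W0 wB] := integral_weight_EFin nw BB_B.
rewrite /avg /mean_osc -muleA; congr (_ * _).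
by rewrite wB inver gt_eqF// muleA -EFinM mulfV ?gt_eqF// mul1e.
Qed.

Lemma Xnorm_ge0 w p f : 0 <= Xnorm mu BB Lambda w p f.
Proof. exact: poweR_ge0. Qed.

Lemma mean_osc_le_Xnorm w p f B : (0 < p)%R -> BB B ->
  mean_osc w p f B <= Xnorm mu BB Lambda w p f `^ p.
Proof.
move=> p0 BB_B; rewrite /Xnorm -poweRrM mulVf ?gt_eqF// poweRe1 ?sup_ge0_ge0//.
by apply: sup_ge0_ubound; exists B.
Qed.

Lemma Xnorm_le w p f (M : \bar R) : (0 < p)%R -> 0 <= M ->
  (forall B, BB B -> mean_osc w p f B <= M `^ p) ->
  Xnorm mu BB Lambda w p f <= M.
Proof.
move=> p0 M0 h.
rewrite -[M in leRHS]poweRe1// -(mulfV (lt0r_neq0 p0)) poweRrM.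
apply: le_poweR; [by rewrite invr_ge0 ltW|exact: sup_ge0_ge0|].
by apply: ge_sup_ge0; [exact: poweR_ge0|move=> _ [B /h ? <-]].
Qed.

(** Hoelder's inequality for the measure with density [w], after writing the
    integrand as [(Lambda^p w)^a (Lambda^r w)^(1 - a)]. *)
Lemma mean_osc_log_convex w f B (p r a : R) : positive_weight w -> BB B ->
  (0 <= p)%R -> (0 <= r)%R -> (0 < a < 1)%R ->
  mean_osc w (p * a + r * (1 - a)) f B <=
  mean_osc w p f B `^ a * mean_osc w r f B `^ (1 - a).
Proof.
move=> nw BB_B p0 r0 a01; have [W W0 wB] := integral_weight_EFin nw BB_B.
have [mw w0 _] := nw; have [mB _] := hBB BB_B; have /andP[a0 a1] := a01.
rewrite /mean_osc wB inver gt_eqF//.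
rewrite (_ : \int[mu]_(x in B) (Lambda f B x `^ (p * a + r * (1 - a)) * w x) =
  \int[mu]_(x in B) ((Lambda f B x `^ p * w x) `^ a *
                     (Lambda f B x `^ r * w x) `^ (1 - a))).
  apply: hoelder_scaled => //.
  - by rewrite invr_ge0 ltW.
  - by apply: emeasurable_funM => //; exact: measurable_osc.
  - by apply: emeasurable_funM => //; exact: measurable_osc.
  - by move=> x; rewrite mule_ge0// poweR_ge0.
  - by move=> x; rewrite mule_ge0// poweR_ge0.
have [a0' b0'] : (0 <= a)%R /\ (0 <= 1 - a)%R by rewrite ltW// subr_ge0 ltW.
apply: eq_integral => x _.
rewrite !poweRM ?poweR_ge0// muleACA -!poweRrM -!poweRD_ge0 ?mulr_ge0//.
by rewrite subrKC poweRe1.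
Qed.

Lemma mean_osc0 w f B : positive_weight w -> BB B -> mean_osc w 0 f B = 1.
Proof.
move=> nw BB_B; have [W W0 wB] := integral_weight_EFin nw BB_B.
rewrite /mean_osc; under [X in _ * X]eq_integral do rewrite poweRe0 mul1e.
by rewrite wB inver gt_eqF// -EFinM mulVf ?gt_eqF.
Qed.

(** Log-convexity with lower exponent 0, where the mean oscillation is 1. *)
Lemma Xnorm_mono w p r f : positive_weight w -> (0 < p)%R -> (p <= r)%R ->
  Xnorm mu BB Lambda w p f <= Xnorm mu BB Lambda w r f.
Proof.
move=> nw p0; rewrite le_eqVlt => /predU1P[->//|pr].
have r0 : (0 < r)%R by exact: lt_trans pr.
apply: Xnorm_le => // [|B BB_B]; first exact: Xnorm_ge0.
have := @mean_osc_log_convex w f B 0 r (1 - p / r) nw BB_B (lexx _) (ltW r0).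
rewrite mul0r add0r subKr mulrCA mulfV ?gt_eqF// mulr1 mean_osc0// poweR1r mul1e.
move=> h; apply: (le_trans (h _)).
  by rewrite subr_gt0 ltr_pdivrMr// mul1r pr/= ltrBlDr ltrDl divr_gt0.
rewrite [leRHS](_ : _ = (Xnorm mu BB Lambda w r f `^ r) `^ (p / r)); last first.
  by rewrite -poweRrM mulrC divfK ?gt_eqF.
apply: le_poweR; [by rewrite divr_ge0 ?ltW|by apply: mean_osc_ge0; case: nw|].
exact: mean_osc_le_Xnorm.
Qed.

(** Interpolating the exponent 1 between [p] and [r]: an upper bound at [r] by
    a finite quantity at 1 can be absorbed, leaving a bound at 1 by [p]. *)
Lemma Xnorm_interpolation w (p r C : R) : positive_weight w ->
  (0 < p)%R -> (p < 1)%R -> (1 < r)%R -> (0 < C)%R ->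
  exists2 K : R, (0 < K)%R & forall f,
    Xnorm mu BB Lambda w 1 f < +oo ->
    Xnorm mu BB Lambda w r f <= C%:E * Xnorm mu BB Lambda w 1 f ->
    Xnorm mu BB Lambda w 1 f <= K%:E * Xnorm mu BB Lambda w p f.
Proof.
move=> nw p0 p1 r1 C0; have r0 : (0 < r)%R by exact: lt_trans r1.
have rp : (0 < r - p)%R by rewrite subr_gt0; exact: lt_trans r1.
pose a := ((r - 1) / (r - p))%R.
have a0 : (0 < a)%R by rewrite divr_gt0// subr_gt0.
have a1 : (a < 1)%R by rewrite ltr_pdivrMr// mul1r ltrD2l ltrN2.
have par : (p * a + r * (1 - a) = 1)%R by rewrite /a; field; rewrite gt_eqF.
clearbody a.
pose t := (p * a)%R.
have t0 : (0 < t)%R by rewrite mulr_gt0.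
have t1 : (t < 1)%R by rewrite -par ltrDl mulr_gt0// subr_gt0.
exists (C `^ ((1 - t) / t))%R; first exact: powR_gt0.
move=> f; set N1 := Xnorm _ _ _ _ 1 f; set Nr := Xnorm _ _ _ _ r f.
set Np := Xnorm _ _ _ _ p f => N1oo NrC.
have Np0 : 0 <= Np by exact: Xnorm_ge0.
have N10 : 0 <= N1 by exact: Xnorm_ge0.
have tr : (r * (1 - a) = 1 - t)%R by rewrite /t -[in RHS]par addrAC subrr add0r.
have main : N1 <= Np `^ t * (C%:E * N1) `^ (1 - t).
  apply: Xnorm_le => // [|B BB_B]; first by rewrite mule_ge0// poweR_ge0.
  have a01 : (0 < a < 1)%R by rewrite a0.
  have := mean_osc_log_convex f nw BB_B (ltW p0) (ltW r0) a01.
  have mo q : 0 <= mean_osc w q f B by apply: mean_osc_ge0; case: nw.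
  rewrite par -/N1 poweRe1 ?mule_ge0 ?poweR_ge0// => /le_trans; apply.
  rewrite -tr /t !poweRrM.
  apply: lee_pmul; rewrite ?poweR_ge0//.
    by apply: le_poweR => //; [exact: ltW|exact: mean_osc_le_Xnorm].
  apply: le_poweR => //; first by rewrite subr_ge0 ltW.
  apply: (le_trans (mean_osc_le_Xnorm _ _ r0 BB_B)).
  by apply: le_poweR => //; [exact: ltW|exact: Xnorm_ge0].
move: N10 N1oo main; case: N1 NrC => // n _; rewrite lee_fin le_eqVlt.
case/predU1P => [<- _ _|n0 _]; first by rewrite mule_ge0// lee_fin powR_ge0.
case: (Np) Np0 => // [m|]; last by rewrite gt0_muley ?leey// lte_fin powR_gt0.
move=> m0; rewrite -(EFinM C n) !poweR_EFin -!EFinM !lee_fin => h.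
have Cn : (0 <= C * n)%R by rewrite mulr_ge0// ltW.
(* dividing by n^(1-t) leaves n^t <= m^t C^(1-t) *)
have {}h : (n `^ t <= m `^ t * C `^ (1 - t))%R.
  rewrite -(@ler_pM2r _ (n `^ (1 - t))%R) ?powR_gt0//.
  rewrite -powRD ?subrKC ?oner_eq0// powRr1 ?(ltW n0)// -mulrA.
  by rewrite -powRM// ltW.
have ti : (0 <= t^-1)%R by rewrite invr_ge0 ltW.
have := @ge0_ler_powR _ _ ti _ _ (powR_ge0 n t) (mulr_ge0 (powR_ge0 _ _) (powR_ge0 _ _)) h.
by rewrite powRM ?powR_ge0// -!powRrM !mulfV ?gt_eqF// !powRr1 ?(ltW n0)// mulrC.
Qed.

(** A single estimate of the exponent [r > 1] by 1 suffices: norms at [q <= r] are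
    below the norm at [r], and the norm at 1 is below a multiple of the norm at
    [p], by monotonicity if [1 <= p] and by interpolation if [p < 1]. *)
Lemma john_nirenberg_down w (r : R) : positive_weight w -> (1 < r)%R ->
  JN_bounds mu BB Lambda w 1 r !=set0 ->
  john_nirenberg mu BB Lambda w `]0%R, r].
Proof.
move=> nw r1 [C [C0 hC]] p q; rewrite /= !in_itv/= => /andP[p0 _] /andP[q0 qr] pq.
have [p1|p1] := ltP p 1%R; last first.
  exists C; split=> // f fX; apply: (le_trans (Xnorm_mono f nw q0 qr)).
  apply: (le_trans (hC _ fX)); apply: lee_wpmul2l; first by rewrite lee_fin ltW.
  exact: Xnorm_mono.
have [K K0 hK] := Xnorm_interpolation nw p0 p1 r1 C0.
exists (C * K)%R; split=> [|f fX]; first exact: mulr_gt0.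
apply: (le_trans (Xnorm_mono f nw q0 qr)).
apply: (le_trans (hC _ fX)); rewrite EFinM -muleA.
by apply: lee_wpmul2l; [rewrite lee_fin ltW|apply: hK => //; exact: hC].
Qed.

Lemma JN_const_ge0 w p q : 0 <= JN_const mu BB Lambda w p q.
Proof. by apply: ereal_inf_ge0 => C [/ltW]. Qed.

Lemma JN_const_lty w p q : JN_bounds mu BB Lambda w p q !=set0 ->
  JN_const mu BB Lambda w p q < +oo.
Proof. exact: ereal_inf_lty. Qed.

Lemma Xnorm_le_JN_const w p q f : JN_bounds mu BB Lambda w p q !=set0 ->
  Xspace mu BB Lambda w 1 f -> Xnorm mu BB Lambda w p f < +oo ->
  Xnorm mu BB Lambda w q f <=
  JN_const mu BB Lambda w p q * Xnorm mu BB Lambda w p f.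
Proof.
move=> JN fX poo; apply: ereal_inf_EFin_mul => //; first exact: Xnorm_ge0.
by move=> C [_]; apply.
Qed.

(** The admissible constants are positive reals, so a vanishing [K] is reached
    only as a limit of [K + e]. *)
Lemma JN_const_le w p q (K : \bar R) : 0 <= K ->
  (forall f, Xspace mu BB Lambda w 1 f ->
     Xnorm mu BB Lambda w q f <= K * Xnorm mu BB Lambda w p f) ->
  JN_const mu BB Lambda w p q <= K.
Proof.
case: K => // [k|]; last by move=> _ _; rewrite leey.
move=> k0 h; rewrite lee_fin in k0; apply/lee_addgt0Pr => e e0; rewrite -EFinD.
apply: ereal_inf_lbound; exists (k + e)%R => //.
split=> [|f /h /le_trans]; first by rewrite ltr_wpDl.
by apply; apply: lee_wpmul2r; [exact: Xnorm_ge0|rewrite lee_fin lerDl ltW].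
Qed.

End oscillation_means.

(** * Muckenhoupt and reverse Hoelder weights *)

Section weights.
Context (R : realType) (d : measure_display) (Y : measurableType d).
Context (mu : {sigma_finite_measure set Y -> \bar R}).
Context (BB : set (set Y)) (F : Type) (Lambda : F -> set Y -> Y -> \bar R).
Hypothesis hBB : admissible_sets mu BB.
Hypothesis hLambda : oscillation BB Lambda.
Implicit Types (w : Y -> \bar R) (f : F).

Lemma conj_exp_gt1 (p : R) : (1 < p)%R -> (1 < conj_exp p)%R.
Proof. by move=> p1; rewrite /conj_exp ltr_pdivlMr ?subr_gt0// mul1r gtrBl. Qed.

Lemma conj_expV (p : R) : (1 < p)%R -> ((conj_exp p)^-1 = 1 - p^-1)%R.
Proof.
move=> p1; rewrite /conj_exp invf_div; field.
by rewrite gt_eqF// (lt_trans ltr01).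
Qed.

Lemma measurable_dual_weight w p : measurable_fun [set: Y] w -> (forall x, 0 <= w x) ->
  measurable_fun [set: Y] (dual_weight p w).
Proof. by move=> mw w0; apply: measurable_fun_poweR; exact: measurable_fun_inve. Qed.

(** The weight and its dual are both integrable over [B], hence finite almost
    everywhere there, and the dual weight is [+oo] wherever [w] vanishes. *)
Lemma Ap_ae w (q : R) B : (1 < q)%R -> Ap mu BB q w -> BB B ->
  {ae mu, forall x, B x -> 0 < w x < +oo}.
Proof.
move=> q1 [w0 [mw iw] dual_oo _] BB_B; have [mB _] := hBB BB_B.
have q0 : (0 < q)%R by exact: lt_trans q1.
have [m m0 muB] := measure_EFin hBB BB_B.
have mdual := measurable_dual_weight q mw w0.
have idual : mu.-integrable B (dual_weight q w).
  apply/integrableP; split; first exact: measurable_funTS.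
  under eq_integral do rewrite gee0_abs ?poweR_ge0//.
  have := dual_oo _ BB_B; rewrite /avg muB inver gt_eqF//.
  rewrite !ltey; apply: contra => /eqP ->.
  by rewrite gt0_muley ?lte_fin ?invr_gt0.
have aew := integrable_ae mB (iw _ BB_B).
have aed := integrable_ae mB idual.
apply: filterS2 aew aed => x + + Bx => /(_ Bx) wx /(_ Bx) dx.
rewrite ltey_eq wx andbT lt0e w0 andbT; apply/negP => /eqP w_eq0.
move: dx; rewrite /dual_weight w_eq0 inve0 poweRyr//.
by rewrite gt_eqF// divr_gt0// (lt_trans ltr01)// conj_exp_gt1.
Qed.

Lemma Ap_positive_weight w (q : R) : (1 < q)%R -> Ap mu BB q w ->
  positive_weight mu BB w.
Proof.
move=> q1 Aw; have [w0 [mw iw] _ _] := Aw; split=> // B BB_B.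
have [mB /andP[muB _]] := hBB BB_B.
apply/andP; split; last first.
  have /integrableP[_] := iw _ BB_B.
  by under eq_integral do rewrite gee0_abs//.
rewrite lt0e integral_ge0// andbT; apply/eqP => iw0.
have aew : ae_eq mu B w (cst 0).
  apply/(ae_eq_integral_abs mu mB (measurable_funTS mw)); rewrite -iw0.
  by apply: eq_integral => x _; rewrite gee0_abs.
have : {ae mu, forall x, ~ B x}.
  apply: filterS2 aew (Ap_ae q1 Aw BB_B) => x + + Bx => /(_ Bx) -> /(_ Bx).
  by rewrite ltxx.
move=> [N [mN N0 BN]].
suff : mu B <= 0 by rewrite leNgt muB.
rewrite -N0; apply: le_measure; rewrite ?inE// => x Bx.
by apply: BN => nBx; exact: nBx Bx.
Qed.

Lemma RH_positive_weight w (delta : R) : RH mu BB delta w -> positive_weight mu BB w.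
Proof. by move=> [[q q1 Aw] _]; exact: Ap_positive_weight Aw. Qed.

(** Writing [Lambda^(1/q) = (Lambda w)^(1/q) w^(-1/q)] and applying Hoelder's
    inequality puts the two factors of the Muckenhoupt condition apart. *)
Lemma Xnorm_le_Ap w (q : R) f : (1 < q)%R -> Ap mu BB q w ->
  Xnorm mu BB Lambda (cst 1) q^-1 f <=
  Ap_const mu BB q w * Xnorm mu BB Lambda w 1 f.
Proof.
move=> q1 Aw; have nw := Ap_positive_weight q1 Aw.
have q0 : (0 < q)%R by exact: lt_trans q1.
have qi0 : (0 < q^-1)%R by rewrite invr_gt0.
have qi1 : (q^-1 < 1)%R by rewrite invf_lt1.
have [w0 [mw iw] _ _] := Aw.
apply: Xnorm_le => // [|B BB_B]; first by rewrite mule_ge0 ?sup_ge0_ge0 ?Xnorm_ge0.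
have [mB _] := hBB BB_B; have [m m0 muB] := measure_EFin hBB BB_B.
have mL r := measurable_osc hLambda f r BB_B.
have L0 x : 0 <= Lambda f B x by exact: (osc_ge0 hLambda).
have mdual := measurable_dual_weight q mw w0.
rewrite (mean_osc1 _ hBB)//.
have -> : avg mu B (fun x => Lambda f B x `^ q^-1) = m^-1%:E * \int[mu]_(x in B)
    ((Lambda f B x `^ 1 * w x) `^ q^-1 * dual_weight q w x `^ (1 - q^-1)).
  rewrite /avg muB inver gt_eqF//; congr (_ * _).
  apply: ge0_ae_eq_integral => //.
  - exact/measurable_funTS.
  - apply/measurable_funTS; apply: emeasurable_funM; last exact: measurable_fun_poweR.
    by apply: measurable_fun_poweR; exact: emeasurable_funM.
  - by move=> x _; exact: poweR_ge0.
  - by move=> x _; rewrite mule_ge0 ?poweR_ge0.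
  apply: filterS (Ap_ae q1 Aw BB_B) => x /[apply].
  rewrite /dual_weight poweRe1//; case: (w x) => [r| |] //; last by rewrite ltxx andbF.
  rewrite !lte_fin => /andP[r0 _].
  rewrite poweRM ?lee_fin ?(ltW r0)// -poweRrM.
  rewrite (_ : (_ * (1 - q^-1))%R = q^-1%R); last first.
    rewrite -(conj_expV q1); have := conj_exp_gt1 q1 => c1.
    by field; rewrite gt_eqF//= gt_eqF// (lt_trans ltr01).
  rewrite inver gt_eqF// -muleA !poweR_EFin -EFinM -powRM ?invr_ge0 ?(ltW r0)//.
  by rewrite mulfV ?gt_eqF// powR1 mule1.
have := @hoelder_scaled R d Y mu B mB (fun x => Lambda f B x `^ 1 * w x)
  (dual_weight q w) q^-1 m^-1.
rewrite qi0 qi1 invr_ge0 (ltW m0) => /(_ isT isT) hoelder.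
apply: (le_trans (hoelder _ _ _ _)) => //.
- exact: emeasurable_funM.
- by move=> x; rewrite mule_ge0 ?poweR_ge0.
- by move=> x; exact: poweR_ge0.
have avgE h : m^-1%:E * \int[mu]_(x in B) h x = avg mu B h.
  by rewrite /avg muB inver gt_eqF.
rewrite !avgE (avg_mean_osc _ hBB)//.
have dual0 : 0 <= avg mu B (dual_weight q w).
  by rewrite -avgE mule_ge0 ?lee_fin ?invr_ge0 ?(ltW m0)// integral_ge0// => x _; exact: poweR_ge0.
have avg0 : 0 <= avg mu B w.
  by rewrite -avgE mule_ge0 ?lee_fin ?invr_ge0 ?(ltW m0)// integral_ge0.
have mo0 : 0 <= mean_osc mu Lambda w 1 f B by exact: mean_osc_ge0.
rewrite (_ : (1 - q^-1)%R = (q / conj_exp q * q^-1)%R); last first.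
  by rewrite -(conj_expV q1) [(q / _)%R]mulrC mulfK ?gt_eqF.
rewrite poweRrM -poweRM; [|exact: mule_ge0|exact: poweR_ge0].
apply: le_poweR; [exact: ltW|by apply: mule_ge0; [exact: mule_ge0|exact: poweR_ge0]|].
rewrite muleAC; apply: lee_pmul => //.
- by apply: mule_ge0 => //; exact: poweR_ge0.
- by apply: sup_ge0_ubound; exists B.
- by rewrite -[leRHS]poweRe1 ?Xnorm_ge0//; exact: mean_osc_le_Xnorm.
Qed.

(** The set of reverse Hoelder constants is closed, so its infimum is the
    smallest one. *)
Lemma RH_const_attained w (delta : R) : positive_weight mu BB w ->
  RH_bounds mu BB delta w !=set0 ->
  exists2 C : R, RH_bounds mu BB delta w C & RH_const mu BB delta w = C%:E.
Proof.
move=> nw RHw.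
have C0 : forall C, RH_bounds mu BB delta w C -> (0 <= C)%R by move=> C [].
have fin : RH_const mu BB delta w \is a fin_num.
  by rewrite ge0_fin_numE ?ereal_inf_lty// ereal_inf_ge0.
exists (fine (RH_const mu BB delta w)); last by rewrite fineK.
split=> [|B BB_B]; first by rewrite fine_ge0// ereal_inf_ge0.
have [k k0 avgw] := avg_weight_EFin hBB nw BB_B.
rewrite fineK//; apply: ereal_inf_EFin_mul => //.
- by rewrite avgw lee_fin ltW.
- by rewrite avgw ltry.
- by move=> C [_]; apply.
Qed.

(** Jensen's inequality [avg w <= (avg w^delta)^(1/delta)]. *)
Lemma RH_bounds_ge1 w (delta C : R) : positive_weight mu BB w -> (1 < delta)%R ->
  BB !=set0 -> RH_bounds mu BB delta w C -> (1 <= C)%R.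
Proof.
move=> nw d1 [B BB_B] [C0 hC]; have d0 : (0 < delta)%R by exact: lt_trans d1.
have [mw w0 _] := nw; have [mB _] := hBB BB_B.
have [m m0 muB] := measure_EFin hBB BB_B.
have [k k0 avgw] := avg_weight_EFin hBB nw BB_B.
have := hC _ BB_B; rewrite avgw => h.
suff jensen : avg mu B w <= avg mu B (fun x => w x `^ delta) `^ delta^-1.
  have := le_trans jensen h; rewrite avgw -EFinM lee_fin.
  by rewrite -[leLHS]mul1r ler_pM2r.
rewrite /avg muB inver gt_eqF//.
have := @hoelder_scaled R d Y mu B mB (fun x => w x `^ delta) (cst 1) delta^-1 m^-1.
rewrite invr_gt0 d0 invf_lt1// d1 invr_ge0 (ltW m0) => /(_ isT isT) hoelder.
have -> : \int[mu]_(x in B) w x = \int[mu]_(x in B)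
    ((w x `^ delta) `^ delta^-1 * (cst 1 x) `^ (1 - delta^-1)).
  apply: eq_integral => x _.
  by rewrite poweR1r mule1 -poweRrM mulfV ?gt_eqF// poweRe1.
apply: (le_trans (hoelder _ _ _ _)).
- exact: measurable_fun_poweR.
- exact: measurable_cst.
- by move=> x; exact: poweR_ge0.
- by move=> x; exact: lee01.
have -> : \int[mu]_(x in B) cst 1 x = m%:E by rewrite integral_cst// mul1e.
rewrite -EFinM mulVf ?gt_eqF// poweR1r mule1.
exact: lexx.
Qed.

(** Hoelder's inequality with exponents [delta'] and [delta] separates
    [Lambda^r w], [r = p0 / delta'], into [Lambda^p0] and [w^delta]. *)
Lemma Xnorm_le_RH w (p0 delta C : R) f : positive_weight mu BB w ->
  (0 < p0)%R -> (1 < delta)%R -> RH_bounds mu BB delta w C ->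
  Xnorm mu BB Lambda w (p0 / conj_exp delta) f <=
  (C `^ (conj_exp delta / p0))%:E * Xnorm mu BB Lambda (cst 1) p0 f.
Proof.
move=> nw p00 d1 [C0 hC]; have d0 : (0 < delta)%R by exact: lt_trans d1.
have c1 := conj_exp_gt1 d1; have c0 : (0 < conj_exp delta)%R by exact: lt_trans c1.
have ci0 : (0 < (conj_exp delta)^-1)%R by rewrite invr_gt0.
have r0 : (0 < p0 / conj_exp delta)%R by rewrite divr_gt0.
have ciE : (1 - (conj_exp delta)^-1 = delta^-1)%R by rewrite conj_expV// subKr.
have [mw w0 _] := nw.
apply: Xnorm_le => // [|B BB_B].
  by rewrite mule_ge0 ?Xnorm_ge0// lee_fin powR_ge0.
have [mB _] := hBB BB_B; have [m m0 muB] := measure_EFin hBB BB_B.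
have [k k0 avgw] := avg_weight_EFin hBB nw BB_B.
have avgE h : avg mu B h = m^-1%:E * \int[mu]_(x in B) h x.
  by rewrite /avg muB inver gt_eqF.
have L0 x : 0 <= Lambda f B x by exact: (osc_ge0 hLambda).
have : avg mu B w * mean_osc mu Lambda w (p0 / conj_exp delta) f B <=
    avg mu B (fun x => Lambda f B x `^ p0) `^ (conj_exp delta)^-1 *
    avg mu B (fun x => w x `^ delta) `^ delta^-1.
  rewrite -(avg_mean_osc _ hBB)// [leLHS]avgE.
  rewrite [in leRHS]avgE [X in _ <= _ * X `^ _]avgE -ciE.
  rewrite (_ : \int[mu]_(x in B) (Lambda f B x `^ (p0 / conj_exp delta) * w x) =
    \int[mu]_(x in B) ((Lambda f B x `^ p0) `^ (conj_exp delta)^-1 *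
       (w x `^ delta) `^ (1 - (conj_exp delta)^-1))); last first.
    apply: eq_integral => x _; rewrite -!poweRrM ciE mulfV ?gt_eqF//.
    by rewrite poweRe1.
  apply: hoelder_scaled => //.
  - by rewrite ci0 invf_lt1.
  - by rewrite invr_ge0 ltW.
  - exact: (measurable_osc hLambda).
  - exact: measurable_fun_poweR.
  - by move=> x; exact: poweR_ge0.
  - by move=> x; exact: poweR_ge0.
move=> /le_trans /(_ (lee_pmul _ _ (lexx _) (hC _ BB_B))).
rewrite !poweR_ge0 => /(_ isT isT); rewrite -(mean_osc1 _ hBB)// avgw.
rewrite [_ * (C%:E * _)]muleA muleC lee_pmul2r// => h.
apply: (le_trans h); rewrite muleC poweRM ?Xnorm_ge0 ?lee_fin ?powR_ge0//.
rewrite poweR_EFin -powRrM (_ : (_ * _)%R = 1%R); last first.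
  by field; rewrite !gt_eqF.
rewrite powRr1//; apply: lee_wpmul2l; first by rewrite lee_fin.
rewrite poweRrM; apply: le_poweR; [exact: ltW|exact: mean_osc_ge0|].
exact: mean_osc_le_Xnorm.
Qed.


End weights.

(** * Comparison of weighted and unweighted oscillation spaces *)

Section comparison.
Context (R : realType) (d : measure_display) (Y : measurableType d).
Context (mu : {sigma_finite_measure set Y -> \bar R}).
Context (BB : set (set Y)) (F : Type) (Lambda : F -> set Y -> Y -> \bar R).
Context (p0 : R).
Hypothesis hBB : admissible_sets mu BB.
Hypothesis hLambda : oscillation BB Lambda.
Hypothesis hp0 : (1 < p0)%R.
Hypothesis hJN : john_nirenberg mu BB Lambda (cst 1) `[1%R, p0].
Hypothesis hX : forall p : R, (0 < p)%R -> (p <= 1)%R ->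
  Xspace mu BB Lambda (cst 1) 1 = Xspace mu BB Lambda (cst 1) p.
Implicit Types (w : Y -> \bar R) (f : F).

Let w1 : positive_weight mu BB (cst 1) := positive_weight_cst1 hBB.

Let JN1 : JN_bounds mu BB Lambda (cst 1) 1 p0 !=set0.
Proof. by apply: hJN => //=; rewrite in_itv/= lexx ?ltW. Qed.

(** This is where the John-Nirenberg property above 1 produces one below 1. *)
Lemma JN_bounds_inv (q : R) : (1 < q)%R ->
  JN_bounds mu BB Lambda (cst 1) q^-1 1 !=set0.
Proof.
move=> q1; have q0 : (0 < q)%R by exact: lt_trans q1.
apply: (john_nirenberg_down hBB hLambda w1 hp0 JN1); last by rewrite invf_lt1.
  rewrite /= in_itv/= invr_gt0 q0/= (le_trans _ (ltW hp0))//.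
  by rewrite invf_le1// ltW.
by rewrite /= in_itv/= ltr01 ltW.
Qed.

Lemma Ap_const_ge0 (q : R) w : 0 <= Ap_const mu BB q w.
Proof. exact: sup_ge0_ge0. Qed.

Lemma Xnorm_le_weighted (q : R) w f : (1 < q)%R -> Ap mu BB q w ->
  Xspace mu BB Lambda (cst 1) 1 f ->
  Xnorm mu BB Lambda (cst 1) 1 f <=
  JN_const mu BB Lambda (cst 1) q^-1 1 * Ap_const mu BB q w *
    Xnorm mu BB Lambda w 1 f.
Proof.
move=> q1 Aw fX; have q0 : (0 < q)%R by exact: lt_trans q1.
have fq : Xnorm mu BB Lambda (cst 1) q^-1 f < +oo.
  apply: le_lt_trans fX; apply: (Xnorm_mono hBB hLambda) => //.
    by rewrite invr_gt0.
  by rewrite invf_le1// ltW.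
apply: (le_trans (Xnorm_le_JN_const (JN_bounds_inv q1) fX fq)).
by rewrite -muleA lee_wpmul2l ?JN_const_ge0//; exact: Xnorm_le_Ap.
Qed.

(** The Muckenhoupt bound only reaches the exponent [1/q < 1]; the identity of the
    spaces for exponents below 1 brings [f] back to exponent 1. *)
Lemma Xspace_weighted_sub (q : R) w f : (1 < q)%R -> Ap mu BB q w ->
  Xspace mu BB Lambda w 1 f -> Xspace mu BB Lambda (cst 1) 1 f.
Proof.
move=> q1 Aw fX; have q0 : (0 < q)%R by exact: lt_trans q1.
rewrite (@hX q^-1) ?invr_gt0 ?invf_le1 ?(ltW q1)//.
apply: le_lt_trans (Xnorm_le_Ap hBB hLambda f q1 Aw) _.
by case: Aw => _ _ _ Aoo; rewrite lte_mul_pinfty ?Ap_const_ge0 ?ge0_fin_numE ?Ap_const_ge0.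
Qed.

Lemma weighted_Xnorm_le w (delta C : R) f : positive_weight mu BB w ->
  (1 < delta)%R -> RH_bounds mu BB delta w C ->
  Xspace mu BB Lambda (cst 1) 1 f ->
  Xnorm mu BB Lambda w (p0 / conj_exp delta) f <=
  JN_const mu BB Lambda (cst 1) 1 p0 * (C `^ (conj_exp delta / p0))%:E *
    Xnorm mu BB Lambda (cst 1) 1 f.
Proof.
move=> nw d1 RHC fX; have p00 : (0 < p0)%R by exact: lt_trans hp0.
apply: (le_trans (Xnorm_le_RH hBB hLambda f nw p00 d1 RHC)).
rewrite muleAC [leRHS]muleC; apply: lee_wpmul2l; first by rewrite lee_fin powR_ge0.
exact: Xnorm_le_JN_const.
Qed.

Lemma conj_expK : conj_exp (conj_exp p0) = p0.
Proof.
rewrite /conj_exp; field.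
have := hp0 => h; apply/andP; split; apply/eqP => e; lra.
Qed.

Lemma Xnorm_le_RH_const w f : RH mu BB (conj_exp p0) w ->
  Xspace mu BB Lambda (cst 1) 1 f ->
  Xnorm mu BB Lambda w 1 f <=
  JN_const mu BB Lambda (cst 1) 1 p0 * RH_const mu BB (conj_exp p0) w *
    Xnorm mu BB Lambda (cst 1) 1 f.
Proof.
move=> RHw fX; have nw := RH_positive_weight hBB RHw.
have [C RHC ->] := RH_const_attained hBB nw RHw.2.
have := weighted_Xnorm_le nw (conj_exp_gt1 hp0) RHC fX.
have p00 : (0 < p0)%R by exact: lt_trans hp0.
by rewrite conj_expK mulfV ?gt_eqF// powRr1//; case: RHC.
Qed.

Lemma RH_const_ge0 (delta : R) w : 0 <= RH_const mu BB delta w.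
Proof. by apply: ereal_inf_ge0 => C []. Qed.

Lemma JN_RH_const_lty w : RH mu BB (conj_exp p0) w ->
  JN_const mu BB Lambda (cst 1) 1 p0 * RH_const mu BB (conj_exp p0) w < +oo.
Proof.
move=> [_ RHw]; apply: lte_mul_pinfty; rewrite ?JN_const_ge0//.
  by rewrite ge0_fin_numE ?JN_const_ge0// JN_const_lty.
exact: ereal_inf_lty.
Qed.

Lemma JN_Ap_const_lty (q : R) w : (1 < q)%R -> Ap mu BB q w ->
  JN_const mu BB Lambda (cst 1) q^-1 1 * Ap_const mu BB q w < +oo.
Proof.
move=> q1 [_ _ _ Aoo]; apply: lte_mul_pinfty; rewrite ?JN_const_ge0//.
by rewrite ge0_fin_numE ?JN_const_ge0// JN_const_lty//; exact: JN_bounds_inv.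
Qed.

Lemma Xspace_weightedE w : RH mu BB (conj_exp p0) w ->
  Xspace mu BB Lambda w 1 = Xspace mu BB Lambda (cst 1) 1.
Proof.
move=> RHw; have [[q q1 Aw] _] := RHw; apply/seteqP; split=> f.
  exact: Xspace_weighted_sub Aw.
move=> fX; apply: le_lt_trans (Xnorm_le_RH_const RHw fX) _.
by apply: lte_mul_pinfty => //; [rewrite mule_ge0 ?JN_const_ge0 ?RH_const_ge0|
  rewrite ge0_fin_numE ?JN_RH_const_lty// mule_ge0 ?JN_const_ge0 ?RH_const_ge0].
Qed.

Lemma weight_invariance_RH :
  weight_invariance mu BB Lambda (RH mu BB (conj_exp p0)).
Proof.
move=> w v RHw RHv; split; first by rewrite !Xspace_weightedE.
have [[q q1 Aw] _] := RHw.
have Kw0 : 0 <= JN_const mu BB Lambda (cst 1) q^-1 1 * Ap_const mu BB q w.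
  by rewrite mule_ge0 ?JN_const_ge0 ?Ap_const_ge0.
have Kv0 : 0 <= JN_const mu BB Lambda (cst 1) 1 p0 * RH_const mu BB (conj_exp p0) v.
  by rewrite mule_ge0 ?JN_const_ge0 ?RH_const_ge0.
have [b b0 hb] := real_upper_bound Kw0 (JN_Ap_const_lty q1 Aw).
have [c c0 hc] := real_upper_bound Kv0 (JN_RH_const_lty RHv).
exists (c * b)%R => [|f]; first exact: mulr_gt0.
rewrite Xspace_weightedE// => fX.
apply: (le_trans (Xnorm_le_RH_const RHv fX)).
apply: (le_trans (hc _ (Xnorm_ge0 _ _ _ _ _ _))).
rewrite EFinM -muleA; apply: lee_wpmul2l; first by rewrite lee_fin ltW.
apply: (le_trans (Xnorm_le_weighted q1 Aw fX)).
exact/hb/Xnorm_ge0.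
Qed.

Lemma conj_exp_lt (sigma : R) : (conj_exp p0 < sigma)%R -> (1 < p0 / conj_exp sigma)%R.
Proof.
move=> ps; have s1 : (1 < sigma)%R by exact: lt_trans (conj_exp_gt1 hp0) ps.
have p00 : (0 < p0)%R by exact: lt_trans hp0.
rewrite -(@ltr_pM2l _ p0^-1) ?invr_gt0// mulr1 mulKf ?gt_eqF// conj_expV//.
rewrite -(conj_expK) conj_expV ?conj_exp_gt1// ltrD2l ltrN2.
by rewrite ltf_pV2// posrE (lt_trans ltr01)// conj_exp_gt1.
Qed.

Lemma weighted_Xnorm_scale (q sigma C : R) w f : (1 < q)%R -> Ap mu BB q w ->
  (conj_exp p0 < sigma)%R -> RH_bounds mu BB sigma w C ->
  Xspace mu BB Lambda w 1 f ->
  Xnorm mu BB Lambda w (p0 / conj_exp sigma) f <=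
  JN_const mu BB Lambda (cst 1) 1 p0 * JN_const mu BB Lambda (cst 1) q^-1 1 *
    (C `^ (conj_exp sigma / p0))%:E * Ap_const mu BB q w *
    Xnorm mu BB Lambda w 1 f.
Proof.
move=> q1 Aw ps RHC fXw; have nw := Ap_positive_weight hBB q1 Aw.
have s1 : (1 < sigma)%R by exact: lt_trans (conj_exp_gt1 hp0) ps.
have fX := Xspace_weighted_sub q1 Aw fXw.
apply: (le_trans (weighted_Xnorm_le nw s1 RHC fX)).
rewrite [X in _ <= X * _ * _]muleAC -[leRHS]muleA -[leRHS]muleA.
apply: lee_wpmul2l.
  by rewrite mule_ge0 ?JN_const_ge0// lee_fin powR_ge0.
by rewrite muleA; exact: Xnorm_le_weighted.
Qed.

Lemma john_nirenberg_weighted (q sigma : R) w : (1 < q)%R -> Ap mu BB q w ->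
  (conj_exp p0 < sigma)%R -> RH mu BB sigma w ->
  john_nirenberg mu BB Lambda w `]0%R, (p0 / conj_exp sigma)%R].
Proof.
move=> q1 Aw ps RHw; have nw := Ap_positive_weight hBB q1 Aw.
apply: (john_nirenberg_down hBB hLambda nw (conj_exp_lt ps)).
have [C RHC _] := RH_const_attained hBB nw RHw.2.
have K0 : 0 <= JN_const mu BB Lambda (cst 1) 1 p0 *
    JN_const mu BB Lambda (cst 1) q^-1 1 *
    (C `^ (conj_exp sigma / p0))%:E * Ap_const mu BB q w.
  by rewrite !mule_ge0 ?JN_const_ge0 ?Ap_const_ge0// lee_fin powR_ge0.
have Koo : JN_const mu BB Lambda (cst 1) 1 p0 *
    JN_const mu BB Lambda (cst 1) q^-1 1 *
    (C `^ (conj_exp sigma / p0))%:E * Ap_const mu BB q w < +oo.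
  rewrite ltey_eq !fin_numM// ge0_fin_numE ?JN_const_ge0 ?Ap_const_ge0 ?JN_const_lty//.
  - exact: JN_bounds_inv.
  - by case: Aw.
have [b b0 hb] := real_upper_bound K0 Koo.
exists b; split=> // f fX.
by apply: (le_trans (weighted_Xnorm_scale q1 Aw ps RHC fX)); exact/hb/Xnorm_ge0.
Qed.

(** [weighted_Xnorm_scale] has the exponent [sigma'/p0 = sigma/(p0(sigma - 1))],
    which is smaller than the one here because [p0' > 1]; the comparison of powers
    uses that a reverse Hoelder constant is at least 1, which holds as soon as
    there is a set [B]. For an empty family all the norms vanish. *)
Lemma JN_const_weighted_le (q sigma : R) w : (1 < q)%R -> Ap mu BB q w ->
  (conj_exp p0 < sigma)%R -> RH mu BB sigma w ->
  JN_const mu BB Lambda w 1 (p0 / conj_exp sigma) <=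
  JN_const mu BB Lambda (cst 1) 1 p0
  * JN_const mu BB Lambda (cst 1) q^-1 1
  * RH_const mu BB sigma w `^ (sigma / (p0 * (sigma - conj_exp p0)))
  * Ap_const mu BB q w.
Proof.
move=> q1 Aw ps RHw; have nw := Ap_positive_weight hBB q1 Aw.
have s1 : (1 < sigma)%R by exact: lt_trans (conj_exp_gt1 hp0) ps.
have [C RHC ->] := RH_const_attained hBB nw RHw.2.
have K0 e : 0 <= JN_const mu BB Lambda (cst 1) 1 p0
  * JN_const mu BB Lambda (cst 1) q^-1 1 * C%:E `^ e * Ap_const mu BB q w.
  by rewrite !mule_ge0 ?JN_const_ge0 ?Ap_const_ge0// poweR_ge0.
apply: JN_const_le => // f fX.
have [BB0|/set0P BB0] := eqVneq BB set0.
  apply: (@le_trans _ _ 0); last by rewrite mule_ge0// Xnorm_ge0.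
  apply: Xnorm_le => // [|B]; last by rewrite BB0.
  exact: lt_trans (conj_exp_lt ps).
apply: (le_trans (weighted_Xnorm_scale q1 Aw ps RHC fX)).
apply: lee_wpmul2r; first exact: Xnorm_ge0.
apply: lee_wpmul2r; first exact: Ap_const_ge0.
apply: lee_wpmul2l; first by rewrite mule_ge0 ?JN_const_ge0.
rewrite poweR_EFin lee_fin; apply: ler_powR; first exact: RH_bounds_ge1 RHC.
have p00 : (0 < p0)%R by exact: lt_trans hp0.
have c1 := conj_exp_gt1 hp0.
have s0 : (0 < sigma)%R by exact: lt_trans s1.
rewrite (_ : conj_exp sigma / p0 = sigma / (p0 * (sigma - 1)))%R; last first.
  by rewrite /conj_exp; field; rewrite !lt0r_neq0// subr_gt0.
apply: ler_wpM2l; first exact: ltW.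
rewrite lef_pV2 ?posrE ?mulr_gt0 ?subr_gt0//.
by apply: ler_wpM2l; [exact: ltW|rewrite lerD2l lerN2 ltW].
Qed.

End comparison.

Theorem theorem3p2 (R : realType) (d : measure_display) (Y : measurableType d)
  (mu : {sigma_finite_measure set Y -> \bar R}) (BB : set (set Y))
  (F : Type) (Lambda : F -> set Y -> Y -> \bar R) (p0 : R)
  (hBB : admissible_sets mu BB)
  (hLambda : oscillation BB Lambda)
  (hp0 : (1 < p0)%R)
  (hJN : john_nirenberg mu BB Lambda (cst 1) `[1%R, p0])
  (hX : forall p : R, (0 < p)%R -> (p <= 1)%R ->
     Xspace mu BB Lambda (cst 1) 1 = Xspace mu BB Lambda (cst 1) p) :
  weight_invariance mu BB Lambda (RH mu BB (conj_exp p0)) /\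
  forall (q : R) (w : Y -> \bar R), (1 < q)%R ->
    Ap mu BB q w -> RH mu BB (conj_exp p0) w ->
    [/\ JN_const mu BB Lambda (cst 1) q^-1 1 < +oo,
        forall f, Xspace mu BB Lambda (cst 1) 1 f ->
          (JN_const mu BB Lambda (cst 1) q^-1 1 * Ap_const mu BB q w)^-1
            * Xnorm mu BB Lambda (cst 1) 1 f
          <= Xnorm mu BB Lambda w 1 f
          <= JN_const mu BB Lambda (cst 1) 1 p0 * RH_const mu BB (conj_exp p0) w
            * Xnorm mu BB Lambda (cst 1) 1 f
      & forall sigma : R, (conj_exp p0 < sigma)%R -> RH mu BB sigma w ->
          john_nirenberg mu BB Lambda w `]0%R, (p0 / conj_exp sigma)%R] /\
          JN_const mu BB Lambda w 1 (p0 / conj_exp sigma)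
          <= JN_const mu BB Lambda (cst 1) 1 p0
             * JN_const mu BB Lambda (cst 1) q^-1 1
             * RH_const mu BB sigma w `^ (sigma / (p0 * (sigma - conj_exp p0)))
             * Ap_const mu BB q w].
Proof.
split=> [|q w q1 Aw RHw].
  exact: (weight_invariance_RH hBB hLambda hp0 hJN hX).
split.
- by apply: JN_const_lty; exact: (JN_bounds_inv hBB hLambda hp0 hJN).
- move=> f fX; apply/andP; split.
    apply: inve_mul_le; rewrite ?Xnorm_ge0//.
    + by rewrite mule_ge0 ?JN_const_ge0 ?Ap_const_ge0.
    + exact: (JN_Ap_const_lty hBB hLambda hp0 hJN).
    + exact: (Xnorm_le_weighted hBB hLambda hp0 hJN).
  exact: (Xnorm_le_RH_const hBB hLambda hp0 hJN).
- move=> sigma ps RHs; split.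
    exact: (john_nirenberg_weighted hBB hLambda hp0 hJN hX q1 Aw).
  exact: (JN_const_weighted_le hBB hLambda hp0 hJN hX).
Qed.
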